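(* Let $k\ge1$ be the cache size and let $G$ be any access graph containing a path with $k+1$ vertices. If $k$ is odd, then \[\mathcal{I}^{G}[\mathrm{FWF},\mathrm{FIFO}]=\left[0,\ 1-\frac1k\right],\] and if $k$ is even, then \[\left[0,\ \frac{k^2-k-1}{k^2}\right]\subseteq \mathcal{I}^{G}[\mathrm{FWF},\mathrm{FIFO}]\subseteq\left[0,\ \frac{k-1}{k}\right].\]
   Context: Paging: a cache holds at most $k$ pages and is initially empty. A request to a page in the cache is a hit; otherwise it is a fault, the page is brought into the cache, evicting a page first if the cache is full. $\mathcal{A}(I)$ is the number of faults of $\mathcal{A}$ on request sequence $I$. FIFO evicts the cached page that entered the cache earliest. FWF (flush-when-full): on a fault with a full cache, it empties the cache and then brings in the requested page. Access graph: a graph $G$ whose vertices are the pages; a request sequence respects $G$ if any two consecutive requests are identical or adjacent in $G$; $L(G)$ is the set of such sequences. Relative interval: $\mathrm{Min}_{\mathcal{A},\mathcal{B}}(n,G)=\min\{\mathcal{A}(I)-\mathcal{B}(I): I\in L(G),|I|=n\}$, $\mathrm{Max}_{\mathcal{A},\mathcal{B}}(n,G)$ analogously with max; $\mathrm{Min}^G(\mathcal{A},\mathcal{B})=\liminf_{n\to\infty}\mathrm{Min}_{\mathcal{A},\mathcal{B}}(n,G)/n$, $\mathrm{Max}^G(\mathcal{A},\mathcal{B})=\limsup_{n\to\infty}\mathrm{Max}_{\mathcal{A},\mathcal{B}}(n,G)/n$, and $\mathcal{I}^G[\mathcal{A},\mathcal{B}]=[\mathrm{Min}^G(\mathcal{A},\mathcal{B}),\mathrm{Max}^G(\mathcal{A},\mathcal{B})]$.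 *)

(* Defs.v *)
From HB Require Import structures.
From mathcomp Require Import all_boot all_order all_algebra.
From mathcomp Require Import all_classical all_reals all_analysis.
Set Implicit Arguments. Unset Strict Implicit. Unset Printing Implicit Defensive.
Import Order.TTheory GRing.Theory Num.Theory.
Local Open Scope classical_set_scope.
Local Open Scope ring_scope.

Section Paging.
Variable V : eqType.

(* A paging algorithm: a step function taking the current cache and the
   requested page, returning the new cache and whether a fault occurred. *)
Definition step_alg := seq V -> V -> seq V * bool.

(* FIFO with cache size k: the cache is kept in order of entry (oldest first). *)
Definition fifo_step (k : nat) : step_alg := fun c p =>
  if p \in c then (c, false)
  else if (size c < k)%N then (rcons c p, true)
  else (rcons (behead c) p, true).

Definition fwf_step (k : nat) : step_alg := fun c p =>
  if p \in c then (c, false)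
  else if (size c < k)%N then (p :: c, true)
  else ([:: p], true).

Fixpoint run (A : step_alg) (c : seq V) (I : seq V) : nat :=
  match I with
  | [::] => 0
  | p :: I' => let: (c', f) := A c p in f + run A c' I'
  end.

Definition faults (A : step_alg) (I : seq V) : nat := run A [::] I.

Definition respects (e : rel V) (I : seq V) : bool :=
  sorted (fun x y => (x == y) || e x y) I.

Definition has_path (e : rel V) (m : nat) : Prop :=
  exists s : seq V, [/\ size s = m, uniq s & sorted e s].

Variable R : realType.
Local Open Scope ereal_scope.

Definition rel_Min (e : rel V) (A B : step_alg) (n : nat) : \bar R :=
  ereal_inf [set ((faults A I)%:R - (faults B I)%:R : R)%:E
            | I in [set I : seq V | respects e I /\ size I = n]].

Definition rel_Max (e : rel V) (A B : step_alg) (n : nat) : \bar R :=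
  ereal_sup [set ((faults A I)%:R - (faults B I)%:R : R)%:E
            | I in [set I : seq V | respects e I /\ size I = n]].

Definition MinG (e : rel V) (A B : step_alg) : \bar R :=
  limn_einf (fun n => rel_Min e A B n * ((n%:R : R)^-1)%:E).

Definition MaxG (e : rel V) (A B : step_alg) : \bar R :=
  limn_esup (fun n => rel_Max e A B n * ((n%:R : R)^-1)%:E).

Definition in_rel_interval (e : rel V) (A B : step_alg) (x : R) : Prop :=
  MinG e A B <= x%:E <= MaxG e A B.

End Paging.

(* Main.v *)
(* Upper bounds: FWF flushes split the request sequence into phases of at most [k]
   distinct pages. A page entered by FIFO stays cached for the rest of the phase,
   so FIFO faults at most as often as FWF in a phase; and FIFO faults at least once
   between two flushes, so FWF makes at most [k] times as many faults, up to [k].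

   Lower bound: sweep back and forth along a path [0, .., k]. Every request is then
   a fault for FWF. On [k + 1] pages FIFO misses exactly one page at any time, and
   the missing pages follow the fixed cyclic order of the first visits. A prefix
   walking outwards from the middle makes this order alternate between the two
   halves, [.., 1, k - 1, 0, k], so that FIFO faults once per sweep of [k] requests,
   except that for even [k] one sweep in every [k] contains two faults. *)
Require Import Defs.
From HB Require Import structures.
From mathcomp Require Import all_boot all_order all_algebra.
From mathcomp Require Import all_classical all_reals all_analysis.
From mathcomp Require Import zify ring lra.
Import Order.TTheory GRing.Theory Num.Theory.
Local Open Scope classical_set_scope.
Local Open Scope ring_scope.

(** * FWF against FIFO on arbitrary request sequences *)

Section Comparison.
Local Open Scope nat_scope.
Context {V : eqType}.
Implicit Types (p : V) (c w I : seq V) (k n : nat) (A : step_alg V).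

Lemma run_cons A c p I : run A c (p :: I) = (A c p).2 + run A (A c p).1 I.
Proof. by rewrite /=; case: (A c p). Qed.

Lemma fifo_hit k c p : p \in c -> fifo_step k c p = (c, false).
Proof. by rewrite /fifo_step => ->. Qed.

Lemma fifo_add k c p : p \notin c -> size c < k -> fifo_step k c p = (rcons c p, true).
Proof. by rewrite /fifo_step => /negbTE -> ->. Qed.

Lemma fifo_evict k c p :
  p \notin c -> k <= size c -> fifo_step k c p = (rcons (behead c) p, true).
Proof. by rewrite /fifo_step => /negbTE ->; rewrite leqNgt => /negbTE ->. Qed.

Lemma fwf_hit k c p : p \in c -> fwf_step k c p = (c, false).
Proof. by rewrite /fwf_step => ->. Qed.

Lemma fwf_add k c p : p \notin c -> size c < k -> fwf_step k c p = (p :: c, true).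
Proof. by rewrite /fwf_step => /negbTE -> ->. Qed.

Lemma fwf_flush k c p : p \notin c -> k <= size c -> fwf_step k c p = ([:: p], true).
Proof. by rewrite /fwf_step => /negbTE ->; rewrite leqNgt => /negbTE ->. Qed.

Lemma run_le_size A c I : run A c I <= size I.
Proof.
elim: I c => // p I IH c; rewrite run_cons /=.
by have := IH (A c p).1; case: (A c p).2 => /=; lia.
Qed.

(* [new] lists the pages that FIFO brought in since the last flush of FWF; they
   all lie in the FWF cache [w], and none of them is evicted before the next flush. *)
Lemma run_fifo_le_fwf k old new w I : 0 < k -> uniq new -> {subset new <= w} ->
  size w <= k -> run (fifo_step k) (old ++ new) I + size new <= run (fwf_step k) w I + size w.
Proof.
move=> k0; elim: I old new w => [|p I IH] old new w un sub sw.
  by rewrite /= !add0n uniq_leq_size.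
have szn : size new <= size w by rewrite uniq_leq_size.
rewrite !run_cons.
have [pc|pc] := boolP (p \in old ++ new).
  rewrite fifo_hit //=.
  have [pw|pw] := boolP (p \in w); first by rewrite fwf_hit //= add0n; exact: IH.
  have [wk|wk] := ltnP (size w) k.
    rewrite fwf_add //=.
    have := IH old new (p :: w) un (fun x xn => mem_behead (s := p :: w) (sub x xn)) wk.
    rewrite /=; lia.
  (* FIFO's whole cache becomes old in the new phase; [size w] pays for the dropped [size new]. *)
  rewrite fwf_flush //=.
  have sub0 : {subset [::] <= [:: p]} by [].
  have := IH (old ++ new) [::] [:: p] isT sub0 k0.
  rewrite cats0 /=; lia.
have [pold pnew] : p \notin old /\ p \notin new.
  by move: pc; rewrite mem_cat negb_or => /andP.
have uqn : uniq (rcons new p) by rewrite rcons_uniq pnew.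
have [pw|pw] := boolP (p \in w).
  have sub' : {subset rcons new p <= w}.
    by move=> x; rewrite mem_rcons inE => /predU1P [->//|/sub].
  have : size (rcons new p) <= size w by rewrite uniq_leq_size.
  rewrite size_rcons => szn'.
  rewrite fwf_hit //=.
  have [lk|lk] := ltnP (size (old ++ new)) k.
    by rewrite fifo_add //= rcons_cat; have := IH old _ w uqn sub' sw; rewrite size_rcons; lia.
  rewrite fifo_evict //=.
  (* The cache is full while [new] has fewer than [k] pages, so the evicted oldest page lies in
     [old]. *)
  case: old {pc pold} lk => [|o old] lk; first by move: lk; rewrite /=; lia.
  by rewrite /= rcons_cat; have := IH old _ w uqn sub' sw; rewrite size_rcons; lia.
have [wk|wk] := ltnP (size w) k.
  have sub' : {subset rcons new p <= p :: w}.
    by move=> x; rewrite mem_rcons !inE => /predU1P [->|/sub ->]; rewrite ?eqxx ?orbT.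
  rewrite fwf_add //=.
  have [lk|lk] := ltnP (size (old ++ new)) k.
    rewrite fifo_add //= rcons_cat.
    by have := IH old _ (p :: w) uqn sub' wk; rewrite size_rcons /=; lia.
  rewrite fifo_evict //=.
  case: old {pc pold} lk => [|o old] lk; first by move: lk; rewrite /=; lia.
  by rewrite /= rcons_cat; have := IH old _ (p :: w) uqn sub' wk; rewrite size_rcons /=; lia.
rewrite fwf_flush //=.
(* Whatever is evicted, [p] ends up last in the FIFO cache and is the new part of the next phase. *)
have [q ->] : exists q, fifo_step k (old ++ new) p = (q ++ [:: p], true).
  have [lk|lk] := ltnP (size (old ++ new)) k.
    by exists (old ++ new); rewrite fifo_add // -cats1.
  by exists (behead (old ++ new)); rewrite fifo_evict // -cats1.
have := IH q [:: p] [:: p] isT (fun x => id) k0; rewrite /=; lia.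
Qed.

Lemma faults_fifo_le_fwf k I : 0 < k -> faults (fifo_step k) I <= faults (fwf_step k) I.
Proof.
move=> k0; have := @run_fifo_le_fwf k [::] [::] [::] I k0 isT (fun x => id) (leq0n k).
by rewrite !addn0.
Qed.

(* [b] records whether FIFO has faulted since the request following the last
   flush of FWF. If it has not, its cache still contains that of FWF, so that a
   request flushing FWF makes FIFO fault too. *)
Lemma run_fwf_le_fifo k (b : bool) c w I : 0 < k -> size c <= k -> uniq w ->
  size w <= k -> (~~ b -> {subset w <= c}) ->
  run (fwf_step k) w I + size w <= k * (run (fifo_step k) c I + b) + k.
Proof.
move=> k0; elim: I b c w => [|p I IH] b c w sc uw sw bwc; first by rewrite /=; lia.
rewrite !run_cons.
have sc' : size (fifo_step k c p).1 <= k.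
  rewrite /fifo_step; case: ifP => // _; case: ifP => [|_] /=; rewrite size_rcons //.
  by rewrite size_behead; lia.
have pc' : p \in (fifo_step k c p).1.
  by rewrite /fifo_step; case: ifP => // _; case: ifP => /=; rewrite mem_rcons mem_head.
have bE : ~~ (b || (fifo_step k c p).2) -> p \in c /\ {subset w <= (fifo_step k c p).1}.
  rewrite negb_or /fifo_step => /andP [/bwc wc].
  by case: ifP => //; case: ifP.
have bf : run (fifo_step k) (fifo_step k c p).1 I + (b || (fifo_step k c p).2) <=
   (fifo_step k c p).2 + run (fifo_step k) (fifo_step k c p).1 I + b.
  by case: b {bwc bE}; case: (_).2 => /=; lia.
set f := (fifo_step k c p).2 in bE bf *; set c' := (fifo_step k c p).1 in bE bf sc' pc' *.
have [pw|pw] := boolP (p \in w).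
  rewrite fwf_hit //= add0n.
  have := IH (b || f) c' w sc' uw sw (fun h => (bE h).2).
  nia.
have [wk|wk] := ltnP (size w) k.
  rewrite fwf_add //=.
  have sub : ~~ (b || f) -> {subset p :: w <= c'}.
    by move=> h x; rewrite inE => /predU1P [->//|]; exact: (bE h).2.
  have := IH (b || f) c' (p :: w) sc' _ wk sub; rewrite /= pw => /(_ uw).
  nia.
rewrite fwf_flush //=.
have sub : ~~ false -> {subset [:: p] <= c'} by move=> _ x; rewrite inE => /eqP ->.
have := IH false c' [:: p] sc' isT k0 sub; rewrite /=.
(* The flush is charged to a FIFO fault. Without one, the full cache [w] would lie in [c], both
   would hold the same pages, and [p] would be in [w]. *)
suff : 0 < f + b by nia.
rewrite addnC lt0n; apply/negP => /eqP fb.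
have nb : ~~ b by case: b {bwc bE bf} fb.
have [pc _] : p \in c /\ {subset w <= c'}.
  by apply: bE; rewrite (negbTE nb); case: f bf fb => //; lia.
have [_ wc] := uniq_min_size uw (bwc nb) (leq_trans sc wk).
by move: pw; rewrite wc pc.
Qed.

Lemma faults_fwf_le_fifo k I : 0 < k ->
  faults (fwf_step k) I <= k * faults (fifo_step k) I + k.
Proof.
move=> k0.
have := @run_fwf_le_fifo k false [::] [::] I k0 (leq0n k) isT (leq0n k) (fun _ x => id).
by rewrite !addn0.
Qed.

End Comparison.

(** * Executions that end in a known cache *)

Section Runs.
Local Open Scope nat_scope.
Set Implicit Arguments.
Unset Strict Implicit.
Context {V : eqType}.
Implicit Types (p : V) (c I : seq V) (k n m : nat) (A : step_alg V).

(** As [run] returns only the number of faults, the final cache is captured by its effect on every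
    continuation [J]; executions then compose by rewriting. *)
Definition runs_to A c I n c' := forall J, run A c (I ++ J) = n + run A c' J.

Lemma runs_to_nil A c : runs_to A c [::] 0 c.
Proof. by []. Qed.

Lemma runs_to_cat A c1 c2 c3 I1 I2 n1 n2 :
  runs_to A c1 I1 n1 c2 -> runs_to A c2 I2 n2 c3 -> runs_to A c1 (I1 ++ I2) (n1 + n2) c3.
Proof. by move=> h1 h2 J; rewrite -catA h1 h2 addnA. Qed.

Lemma runs_to1 A c p : runs_to A c [:: p] (A c p).2 (A c p).1.
Proof. by move=> J; rewrite cat1s run_cons. Qed.

Lemma runs_to_rcons A c1 c2 I p n :
  runs_to A c1 I n c2 -> runs_to A c1 (rcons I p) (n + (A c2 p).2) (A c2 p).1.
Proof. by move=> h; rewrite -cats1; apply: runs_to_cat h (runs_to1 _ _ _). Qed.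

Lemma run_runs_to A c I n c' : runs_to A c I n c' -> run A c I = n.
Proof. by move=> h; rewrite -[I]cats0 h addn0. Qed.

Lemma runs_to_nseq A c I n t :
  runs_to A c I n c -> runs_to A c (flatten (nseq t I)) (t * n) c.
Proof. by move=> h; elim: t => // t IH; rewrite mulSn; exact: runs_to_cat h IH. Qed.

Lemma fifo_runs_hits k c I : {subset I <= c} -> runs_to (fifo_step k) c I 0 c.
Proof.
elim: I => // p I IH sub; rewrite -cat1s -[0]/(0 + 0); apply: (@runs_to_cat _ _ c).
  by move=> J; rewrite cat1s run_cons fifo_hit // sub ?mem_head.
by apply: IH => x xI; apply: sub; rewrite inE xI orbT.
Qed.

Lemma fwf_runs_hits k c I : {subset I <= c} -> runs_to (fwf_step k) c I 0 c.
Proof.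
elim: I => // p I IH sub; rewrite -cat1s -[0]/(0 + 0); apply: (@runs_to_cat _ _ c).
  by move=> J; rewrite cat1s run_cons fwf_hit // sub ?mem_head.
by apply: IH => x xI; apply: sub; rewrite inE xI orbT.
Qed.

Lemma fwf_runs_fill k c I : uniq (I ++ c) -> size I + size c <= k ->
  runs_to (fwf_step k) c I (size I) (rev I ++ c).
Proof.
elim: I c => // p I IH c /= /andP [pIc uIc] sIc.
have /andP [pI pc] : (p \notin I) && (p \notin c) by rewrite -negb_or -mem_cat.
rewrite -cat1s rev_cons cat_rcons -[(size I).+1]/(1 + size I).
apply: (@runs_to_cat _ _ (p :: c)).
  by move=> J; rewrite cat1s run_cons fwf_add //=; lia.
apply: IH; last by rewrite /=; lia.
by rewrite -cat1s uniq_catCA /= mem_cat negb_or pI pc.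
Qed.

(* Each of the [k] new pages is a fault, and the last one flushes the full cache. *)
Lemma fwf_runs_flush k a I p : uniq (a :: rcons I p) -> (size I).+1 = k ->
  runs_to (fwf_step k) [:: a] (rcons I p) k [:: p].
Proof.
move=> u sI.
have := u; rewrite -rcons_cons rcons_uniq => /andP [paI uaI].
have h : runs_to (fwf_step k) [:: a] I (size I) (rev I ++ [:: a]).
  by apply: fwf_runs_fill; rewrite ?cats1 ?rcons_uniq //=; lia.
have := runs_to_rcons p h.
rewrite fwf_flush; first by rewrite /= addn1 sI.
  by rewrite mem_cat mem_rev -mem_cat cats1 mem_rcons.
by rewrite size_cat size_rev addn1 sI.
Qed.

End Runs.

(** * The zigzag on the path [0, .., k] *)

Section Zigzag.
Local Open Scope nat_scope.
Set Implicit Arguments.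
Unset Strict Implicit.
Implicit Types (a b x i j k n m : nat) (c I : seq nat).

Definition adjn : rel nat := fun x y => (y == x.+1) || (x == y.+1).

(** The walk from [a] to [b] without its starting page, so that consecutive walks can be
    concatenated. *)
Definition seg a b := if a <= b then iota a.+1 (b - a) else rev (iota b (a - b)).

Lemma mem_seg a b x : (x \in seg a b) = (minn a b <= x <= maxn a b) && (x != a).
Proof. by rewrite /seg; case: leqP => ab; rewrite ?mem_rev mem_iota; lia. Qed.

Lemma seg_uniq a b : uniq (seg a b).
Proof. by rewrite /seg; case: leqP => ab; rewrite ?rev_uniq iota_uniq. Qed.

Lemma size_seg a b : size (seg a b) = (b - a) + (a - b).
Proof. by rewrite /seg; case: leqP => ab; rewrite ?size_rev size_iota; lia. Qed.

Lemma seg_cat a x b : minn a b <= x <= maxn a b -> seg a b = seg a x ++ seg x b.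
Proof.
rewrite /seg => h; case: (leqP a b) => ab.
  have -> : a <= x by lia.
  have -> : x <= b by lia.
  have -> : b - a = (x - a) + (b - x) by lia.
  by rewrite iotaD; congr (_ ++ iota _ _); lia.
have [xa|xa] := leqP a x.
  have -> : x = a by lia.
  by rewrite subnn /= leqNgt ab.
have [bx|bx] := leqP x b.
  have -> : x = b by lia.
  by rewrite subnn /= cats0.
have -> : a - b = (x - b) + (a - x) by lia.
by rewrite iotaD rev_cat; congr (rev (iota _ _) ++ _); lia.
Qed.

Lemma seg_last a b : a != b ->
  exists2 I, seg a b = rcons I b & forall x, x \in I -> x \in seg a b /\ x != b.
Proof.
move=> ab.
have [I E] : exists I, seg a b = rcons I b.
  rewrite /seg; case: leqP => h.
    have -> : b - a = (b - a).-1 + 1 by lia.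
    rewrite iotaD /= cats1; exists (iota a.+1 (b - a).-1); congr rcons; lia.
  have -> : a - b = (a - b).-1.+1 by lia.
  by rewrite /= rev_cons; exists (rev (iota b.+1 (a - b).-1)).
exists I => // x xI; have := seg_uniq a b; rewrite E rcons_uniq => /andP [bI _].
by rewrite mem_rcons inE xI orbT; split=> //; apply: contraNneq bI => <-.
Qed.

Lemma seg_path a b : path adjn a (seg a b).
Proof.
have up m : path adjn a (iota a.+1 m).
  elim: m a => //= m IH a'; rewrite IH andbT /adjn eqxx //.
have down m d : path adjn (d + m) (rev (iota d m)).
  elim: m d => // m IH d; rewrite -addn1 iotaD /= rev_cat /= addn1 addnS IH.
  by rewrite andbT /adjn eqxx orbT.
rewrite /seg; case: leqP => h //.
by have := down (a - b) b; have -> : b + (a - b) = a by lia.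
Qed.

Lemma last_seg a b : last a (seg a b) = b.
Proof.
have [->|ab] := eqVneq a b; first by rewrite /seg leqnn subnn.
by have [I -> _] := seg_last ab; rewrite last_rcons.
Qed.

(* The numbers [0, .., k] in the order [k, 0, k - 1, 1, k - 2, ..]. *)
Definition zig k i := if odd i then i./2 else k - i./2.

Lemma zig_odd k i : zig k i.*2.+1 = i.
Proof. by rewrite /zig /= odd_double /=; lia. Qed.

Lemma zig_even k i : zig k i.*2 = k - i.
Proof. by rewrite /zig odd_double doubleK. Qed.

Lemma zig_le k i : i <= k -> zig k i <= k.
Proof. by rewrite /zig; case: ifP; lia. Qed.

Lemma zig_inj k i j : i <= k -> j <= k -> zig k i = zig k j -> i = j.
Proof. by rewrite /zig; case: ifP; case: ifP; lia. Qed.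

(* The FIFO cache, oldest page first, when the pages enter in the cyclic order
   [zig k k, .., zig k 0] and [zig k i] is the missing one. *)
Definition queue k i := map (zig k) (rev (iota 0 i) ++ rev (iota i.+1 (k - i))).

(** The cyclic predecessor modulo [k + 1]: the index of the page evicted when [zig k i] is
    requested. *)
Definition prev_idx k i := if i is i'.+1 then i' else k.

Lemma size_queue k i : i <= k -> size (queue k i) = k.
Proof. by move=> ik; rewrite size_map size_cat !size_rev !size_iota; lia. Qed.

Lemma mem_queue k i x : i <= k -> (x \in queue k i) = (x <= k) && (x != zig k i).
Proof.
move=> ik; apply/mapP/andP => [[j jL ->]|[xk xi]].
  have [jk ji] : j <= k /\ j <> i by move: jL; rewrite mem_cat !mem_rev !mem_iota; lia.
  by split; [exact: zig_le|apply/eqP => /(zig_inj jk ik)].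
have [j jk jx] : exists2 j, j <= k & zig k j = x.
  (* Small pages have the odd index [2x + 1], all others the even index [2(k - x)]. *)
  have [h|h] := ltnP x.*2 k; first by exists x.*2.+1; rewrite ?zig_odd.
  by exists (k - x).*2; rewrite ?zig_even; lia.
exists j => //; rewrite mem_cat !mem_rev !mem_iota.
have : j <> i by move=> ji; rewrite -jx ji eqxx in xi.
lia.
Qed.

Lemma fifo_queue_miss k i : 0 < k -> i <= k ->
  fifo_step k (queue k i) (zig k i) = (queue k (prev_idx k i), true).
Proof.
have revS m n : rev (iota m n.+1) = (m + n) :: rev (iota m n).
  by rewrite -addn1 iotaD rev_cat.
move=> k0 ik; rewrite fifo_evict ?size_queue ?mem_queue ?eqxx ?andbF //.
rewrite /queue behead_map -map_rcons; congr (map _ _, _); case: i ik => [|i] ik /=.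
  rewrite subnn subn0 /= cats0; case: k k0 {ik} => // k _.
  by rewrite revS /= -rev_cons.
rewrite revS /= rcons_cat -rev_cons; congr (_ ++ rev _).
by have -> : k - i = (k - i.+1).+1 by lia.
Qed.

(** All pages before [zig k i] are cached. The fault there leaves only [zig k (prev_idx k i)]
    missing, and the rest of the walk avoids that page. *)
Lemma fifo_queue_seg k i a b : 0 < k -> i <= k -> a <= k -> b <= k -> zig k i != a ->
  minn a b <= zig k i <= maxn a b ->
  zig k (prev_idx k i) \notin seg (zig k i) b ->
  runs_to (fifo_step k) (queue k i) (seg a b) 1 (queue k (prev_idx k i)).
Proof.
move=> k0 ik ak bk zi h zp; rewrite (seg_cat h) -[1]/(1 + 0).
apply: (@runs_to_cat _ _ _ (queue k (prev_idx k i))).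
  have [|I IE HI] := @seg_last a (zig k i); first by rewrite eq_sym.
  rewrite IE.
  have := @runs_to_rcons _ (fifo_step k) (queue k i) (queue k i) I (zig k i) 0.
  rewrite fifo_queue_miss // add0n; apply; apply: fifo_runs_hits => x /HI [].
  rewrite mem_seg mem_queue // => /andP [hx _] ->; rewrite andbT; lia.
apply: fifo_runs_hits => x xs; rewrite mem_queue; last by case: (i) ik => /=; lia.
apply/andP; split; last by apply: contraNneq zp => <-.
by move: xs; rewrite mem_seg; lia.
Qed.

(** For odd [i] the next missing page lies above [zig k i], so the rest of the descent does not meet
    it. *)
Lemma fifo_queue_down k i a : 0 < k -> odd i -> i <= k -> zig k i < a <= k ->
  runs_to (fifo_step k) (queue k i) (seg a 0) 1 (queue k i.-1).
Proof.
move=> k0 oi ik ha; have -> : i.-1 = prev_idx k i by case: i oi {ik ha}.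
apply: fifo_queue_seg; rewrite ?min0n //; try lia.
rewrite mem_seg; have iE := odd_double_half i; rewrite oi add1n in iE.
by move: ha; rewrite -iE /= zig_odd zig_even; lia.
Qed.

(** For even [i > 0] the next missing page, [i / 2 - 1], lies below [zig k i]; for [i = 0] the fault
    is at [k], where the sweep ends. *)
Lemma fifo_queue_up k i : 0 < k -> ~~ odd i -> i <= k ->
  runs_to (fifo_step k) (queue k i) (seg 0 k) 1 (queue k (prev_idx k i)).
Proof.
move=> k0 oi ik; have iE := odd_double_half i; rewrite (negbTE oi) add0n in iE.
have zE := zig_even k i./2; rewrite iE in zE.
apply: fifo_queue_seg; rewrite ?zE //; try lia.
rewrite mem_seg; case: i {zE} oi ik iE => [|i] oi ik iE /=; first by rewrite subn0; lia.
have oi' : odd i by move: oi => /=; rewrite negbK.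
by rewrite {1 2}/zig oi'; lia.
Qed.

(** The missing index drops by one per sweep, odd before a descent and even before an ascent, from
    [2t - 1] to [0] and on to [k]. Writing the start with [prev_idx] covers [t = 0]. *)
Lemma fifo_zigzag k t : 0 < k -> t.*2 <= k.+1 ->
  runs_to (fifo_step k) (queue k (prev_idx k t.*2)) (flatten (nseq t (seg k 0 ++ seg 0 k)))
    t.*2 (queue k k).
Proof.
move=> k0; elim: t => [|t IH] tk; first exact: runs_to_nil.
rewrite doubleS /= -[t.*2.+2]/(1 + 1 + t.*2).
apply: runs_to_cat (IH _); last by lia.
apply: runs_to_cat; last by apply: fifo_queue_up; rewrite ?odd_double //; lia.
apply: fifo_queue_down; rewrite //= ?odd_double // ?zig_odd; lia.
Qed.

(** For odd [k], each of the [k + 1] sweeps faults once. For even [k], the first descent meets the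
    missing page [k / 2] and then [k / 2 - 1], just evicted for it, so [k] sweeps give [k + 1]
    faults. *)
Lemma fifo_period k : 0 < k ->
  runs_to (fifo_step k) (queue k k) (flatten (nseq (uphalf k) (seg k 0 ++ seg 0 k)))
    k.+1 (queue k k).
Proof.
move=> k0; have kE := odd_double_half k; have uE := uphalf_half k.
case ok: (odd k) kE uE => kE uE.
  have u2 : (uphalf k).*2 = k.+1 by lia.
  by have := @fifo_zigzag k (uphalf k) k0; rewrite u2 /=; apply.
case: (k./2) kE uE => [|t] kE uE; first by lia.
have -> : uphalf k = t.+1 by lia.
have -> : k.+1 = ((1 + 1) + 1) + t.*2 by lia.
rewrite /=.
apply: runs_to_cat (fifo_zigzag _ _) => //; last by lia.
apply: (@runs_to_cat _ _ _ (queue k t.*2)); last first.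
  by apply: fifo_queue_up; rewrite ?odd_double //; lia.
have zk : zig k k = t.+1 by rewrite -{2}kE zig_even; lia.
have zk1 : zig k k.-1 = t by rewrite -{2}kE zig_odd.
(* The first descent is cut at its first fault, the page [t.+1 = k / 2]. *)
rewrite (@seg_cat k t.+1 0); last by lia.
apply: (@runs_to_cat _ _ _ (queue k k.-1)).
  have := @fifo_queue_seg k k k t.+1 k0; rewrite zk.
  have -> : prev_idx k k = k.-1 by case: (k) k0.
  apply; rewrite ?mem_seg //; lia.
have -> : t.*2 = k.-1.-1 by lia.
apply: fifo_queue_down => //; rewrite ?zk1; lia.
Qed.

(** At every turn the cache holds only the end page, so the next sweep consists of [k] faults, the
    last one a flush. *)
Lemma fwf_period k t : 0 < k ->
  runs_to (fwf_step k) [:: k] (flatten (nseq t (seg k 0 ++ seg 0 k))) (t * k.*2) [:: k].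
Proof.
move=> k0; apply: runs_to_nseq; rewrite -addnn.
have aux a b : a != b -> (b - a) + (a - b) = k ->
    runs_to (fwf_step k) [:: a] (seg a b) k [:: b].
  move=> ab ks; have := seg_uniq a b; have := size_seg a b; have := @mem_seg a b a.
  have [I -> _] := seg_last ab; rewrite size_rcons eqxx andbF => aI sI uI.
  by apply: fwf_runs_flush; [rewrite /= aI | rewrite sI].
by apply: (@runs_to_cat _ _ _ [:: 0]); apply: aux; lia.
Qed.

(** The prefix: legs from the middle page [zig k k] to [zig k (k - 1)], [zig k (k - 2)] and so on,
    on alternating sides. *)
Fixpoint zig_walk k j :=
  if j is j'.+1 then zig_walk k j' ++ seg (zig k (k - j')) (zig k (k - j)) else [:: zig k k].

(** The pages of index above [i] form an interval with [zig k i.+1] at one end, and [zig k i] is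
    next to the other end. Hence a leg passes only visited pages before its last one. *)
Lemma zig_seg k i x : i < k -> x \in seg (zig k i.+1) (zig k i) -> x != zig k i ->
  x \in map (zig k) (rev (iota i.+1 (k - i))).
Proof.
move=> ik; rewrite mem_seg => /andP [hx xi] xi'.
have iE := odd_double_half i.
have xk : x <= k by have := zig_le (ltnW ik); have := zig_le ik; lia.
have [y /andP [iy yk] ->] : exists2 y, i < y <= k & x = zig k y.
  have [h|h] := ltnP x.*2 k; [exists x.*2.+1; last by rewrite zig_odd
    | exists (k - x).*2; last by rewrite zig_even; lia];
  by case: (odd i) iE => /= iE;
    rewrite -iE ?add1n ?add0n -?doubleS ?zig_odd ?zig_even in hx xi xi' *; lia.
by apply: map_f; rewrite mem_rev mem_iota; lia.
Qed.

(** Each leg faults only at its last page, and no cache overflows up to [k] pages. FWF lists them in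
    reverse since it adds in front. *)
Lemma zig_walk_fill k j : j < k ->
  let c := map (zig k) (rev (iota (k - j) j.+1)) in
  runs_to (fifo_step k) [::] (zig_walk k j) j.+1 c /\
  runs_to (fwf_step k) [::] (zig_walk k j) j.+1 (rev c).
Proof.
elim: j => [|j IH] jk /=.
  rewrite subn0; split => J; rewrite /= /fifo_step /fwf_step in_nil /= jk //.
have [h1 h2] := IH (ltnW jk).
set i := k - j.+1.
have iE : k - j = i.+1 by lia.
rewrite iE in h1 h2 *.
have cE : map (zig k) (rev (i :: iota i.+1 j.+1)) =
    rcons (map (zig k) (rev (iota i.+1 j.+1))) (zig k i).
  by rewrite rev_cons map_rcons.
rewrite [i.+1 :: _]/(iota i.+1 j.+1) cE rev_rcons.
set c := map (zig k) (rev (iota i.+1 j.+1)) in h1 h2 *.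
have ic : zig k i \notin c.
  by apply/mapP => -[y]; rewrite mem_rev mem_iota => hy /zig_inj; lia.
have ij : k - i = j.+1 by lia.
have [|I IE HI] := @seg_last (zig k i.+1) (zig k i); first by apply/eqP => /zig_inj; lia.
rewrite IE.
have Ic x : x \in I -> x \in c.
  by case/HI => xs xi; rewrite /c -ij; apply: zig_seg => //; lia.
have sc : size c = j.+1 by rewrite size_map size_rev size_iota.
split; rewrite -[j.+2]addn1.
  apply: runs_to_cat h1 _.
  have := runs_to_rcons (zig k i) (fifo_runs_hits k Ic).
  by rewrite fifo_add ?sc.
apply: runs_to_cat h2 _.
have Irc : {subset I <= rev c} by move=> x /Ic; rewrite mem_rev.
have := runs_to_rcons (zig k i) (fwf_runs_hits k Irc).
by rewrite fwf_add ?size_rev ?sc ?mem_rev.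
Qed.

(** The last leg, from [0] to [k], ends with the first fault on a full cache: FIFO evicts its oldest
    page [zig k k], and FWF flushes. *)
Lemma zig_walk_full k : 0 < k ->
  runs_to (fifo_step k) [::] (zig_walk k k) k.+1 (queue k k) /\
  runs_to (fwf_step k) [::] (zig_walk k k) k.+1 [:: k].
Proof.
case: k => // k _; have [] := @zig_walk_fill k.+1 k (ltnSn k).
rewrite /= subSn // subnn -[1 :: iota 2 k]/(iota 1 k.+1) => h1 h2.
have cE : map (zig k.+1) (rev (iota 1 k.+1)) = queue k.+1 0 by rewrite /queue subn0.
have z0 : zig k.+1 0 = k.+1 by [].
have z1 : zig k.+1 1 = 0 by [].
rewrite cE in h1 h2; rewrite subnn z0 z1.
have [|I IE HI] := @seg_last 0 k.+1; first by [].
rewrite IE.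
have Ic x : x \in I -> x \in queue k.+1 0.
  by case/HI; rewrite mem_seg mem_queue // z0 => xs ->; lia.
split; rewrite -[k.+2]addn1.
  apply: runs_to_cat h1 _.
  have := runs_to_rcons k.+1 (fifo_runs_hits k.+1 Ic).
  by rewrite -{2 4}z0 fifo_queue_miss.
apply: runs_to_cat h2 _.
have Irc : {subset I <= rev (queue k.+1 0)} by move=> x /Ic; rewrite mem_rev.
have := runs_to_rcons k.+1 (fwf_runs_hits k.+1 Irc).
by rewrite fwf_flush ?size_rev ?size_queue // mem_rev mem_queue // z0 eqxx andbF.
Qed.

(** * Assembly of the request sequence *)

Definition walk k a I b := [&& path adjn a I, last a I == b & all (leq^~ k) I].

Lemma walk_cat k a b d I J : walk k a I b -> walk k b J d -> walk k a (I ++ J) d.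
Proof.
rewrite /walk cat_path last_cat all_cat => /and3P [-> /eqP -> ->] /and3P [-> -> ->] //.
Qed.

Lemma walk_seg k a b : a <= k -> b <= k -> walk k a (seg a b) b.
Proof.
move=> ak bk; rewrite /walk seg_path last_seg eqxx /=; apply/allP => x; rewrite mem_seg; lia.
Qed.

Lemma walk_nseq k a I t : walk k a I a -> walk k a (flatten (nseq t I)) a.
Proof.
move=> h; elim: t => [|t IH] /=; first by rewrite /walk /= eqxx.
exact: walk_cat h IH.
Qed.

Lemma zig_walk_walk k j : j <= k ->
  exists2 I, zig_walk k j = zig k k :: I & walk k (zig k k) I (zig k (k - j)).
Proof.
elim: j => [|j IH] jk; first by exists [::]; rewrite // /walk /= subn0 eqxx.
have [I IE w] := IH (ltnW jk).
exists (I ++ seg (zig k (k - j)) (zig k (k - j.+1))); first by rewrite /= IE.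
by apply: walk_cat w _; apply: walk_seg; apply: zig_le; lia.
Qed.

(** The length of [uphalf k] double sweeps, after which FIFO has its initial queue again. *)
Definition period k := uphalf k * k.*2.

(** The prefix costs both algorithms [k + 1] faults and its length [m] is independent of [t], so
    only the periods matter in the limit. *)
Lemma zigzag_sequence k : 0 < k -> exists m, forall t, exists I : seq nat,
  [/\ sorted adjn I, all (leq^~ k) I, size I = m + t * period k,
      run (fwf_step k) [::] I = k.+1 + t * period k &
      run (fifo_step k) [::] I = k.+1 + t * k.+1].
Proof.
move=> k0; exists (size (zig_walk k k)) => t; rewrite /period.
set W := flatten (nseq (uphalf k) (seg k 0 ++ seg 0 k)).
have wW : walk k k W k.
  by apply: walk_nseq; apply: (@walk_cat _ _ 0); apply: walk_seg.
have [I IE wI] := zig_walk_walk (leqnn k); have zk := zig_le (leqnn k).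
have z0 : zig k (k - k) = k by rewrite subnn /zig /= subn0.
rewrite z0 in wI.
have [hfifo hfwf] := zig_walk_full k0.
exists (zig_walk k k ++ flatten (nseq t W)).
have /and3P [p _ a] := walk_cat wI (walk_nseq t wW).
have sW n (J : seq nat) : size (flatten (nseq n J)) = n * size J.
  by rewrite size_flatten /shape map_nseq sumn_nseq mulnC.
split.
- by rewrite IE.
- by rewrite IE /= zk.
- by rewrite !size_cat !sW size_cat !size_seg; lia.
- exact: run_runs_to (runs_to_cat hfwf (runs_to_nseq _ (fwf_period _ k0))).
- exact: run_runs_to (runs_to_cat hfifo (runs_to_nseq _ (fifo_period k0))).
Qed.

End Zigzag.

(** * Invariance under renaming of pages *)

Section Transport.
Local Open Scope nat_scope.
Set Implicit Arguments.
Unset Strict Implicit.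
Context {T V : eqType} (f : T -> V) (D : {pred T}).
Hypothesis f_inj : {in D &, injective f}.
Implicit Types (c I : seq T) (k : nat).

Let mem_map_dom c p : p \in D -> all (mem D) c -> (f p \in map f c) = (p \in c).
Proof.
move=> pD /allP cD; apply/mapP/idP => [[q qc fpq]|pc]; last by exists p.
by rewrite (f_inj _ _ fpq) //; exact: cD.
Qed.

Lemma run_fifo_map k c I : all (mem D) c -> all (mem D) I ->
  run (fifo_step k) (map f c) (map f I) = run (fifo_step k) c I.
Proof.
elim: I c => // p I IH c cD; rewrite map_cons !run_cons /= => /andP [pD ID].
rewrite /fifo_step mem_map_dom // size_map behead_map -!map_rcons.
case: ifP => _ /=; first by rewrite IH.
have bD : all (mem D) (behead c) by case: (c) cD => //= ? ? /andP [].
by case: ifP => _ /=; rewrite IH // all_rcons /= [p \in _]pD.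
Qed.

Lemma run_fwf_map k c I : all (mem D) c -> all (mem D) I ->
  run (fwf_step k) (map f c) (map f I) = run (fwf_step k) c I.
Proof.
elim: I c => // p I IH c cD; rewrite map_cons !run_cons /= => /andP [pD ID].
rewrite /fwf_step mem_map_dom // size_map.
case: ifP => _ /=; first by rewrite IH.
case: ifP => _ /=; first by rewrite -map_cons IH //= [p \in _]pD.
by rewrite -/(map f [:: p]) IH //= [p \in _]pD.
Qed.

End Transport.

(** * Bounds on the limit superior *)

Section LimSup.
Context {R : realType}.
Implicit Types (u : (\bar R)^nat) (a : R).

(** The limit superior is below every tail supremum, and the tail from some [N > 1 / eps] on stays
    below [a + eps]. *)
Lemma limn_esup_le u a :
  (forall n, (0 < n)%N -> (u n <= (a + n%:R^-1)%:E)%E) -> (limn_esup u <= a%:E)%E.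
Proof.
move=> h; rewrite limn_esup_lim (cvg_lim _ (cvg_esups_inf (u := u))) //.
apply/lee_addgt0Pr => eps eps0.
set N := (Num.trunc eps^-1).+1.
have Neps : N%:R^-1 < eps by rewrite invf_plt ?posrE ?ltr0n // truncnS_gt.
apply: (@le_trans _ _ (esups u N)); first by apply: ereal_inf_lbound; exists N.
apply: ge_ereal_sup => _ [n /= Nn <-]; have n0 : (0 < n)%N by exact: leq_trans Nn.
apply: le_trans (h n n0) _; rewrite -EFinD lee_fin lerD2l.
by apply: le_trans (ltW Neps); rewrite lef_pV2 ?posrE ?ltr0n // ler_nat.
Qed.

Lemma limn_esup_ge u a :
  (forall (eps : R) N, 0 < eps -> exists2 n, (N <= n)%N & ((a - eps)%:E <= u n)%E) ->
  (a%:E <= limn_esup u)%E.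
Proof.
move=> h; rewrite limn_esup_lim (cvg_lim _ (cvg_esups_inf (u := u))) //.
apply: le_ereal_inf_tmp => _ [N _ <-].
apply/lee_addgt0Pr => eps eps0; have [n Nn un] := h eps N eps0.
rewrite -leeBlDr // -EFinB; apply: le_trans un _.
by apply: ereal_sup_ubound; exists n.
Qed.

End LimSup.

(** * The two ends of the relative interval *)

Section Intervals.
Context {R : realType} {V : eqType} {e : rel V} {k : nat}.
Hypotheses (e_sym : symmetric e) (k_gt0 : (0 < k)%N) (e_path : has_path e k.+1).

(** Numbering the vertices of the path by [0, .., k] carries the zigzag over to the graph; descents
    use the symmetry of [e]. *)
Lemma bad_requests : exists m, forall t, exists I : seq V,
  [/\ respects e I, size I = (m + t * period k)%N,
      faults (fwf_step k) I = (k.+1 + t * period k)%N &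
      faults (fifo_step k) I = (k.+1 + t * k.+1)%N].
Proof.
have [[|x0 s] [//= [ss] us es]] := e_path.
have [m hm] := zigzag_sequence k_gt0.
exists m => t; have [I [adjI kI sI fwfI fifoI]] := hm t.
pose f := nth x0 (x0 :: s).
have f_inj : {in [pred x | x <= k]%N &, injective f}.
  by move=> x y xk yk /eqP; rewrite nth_uniq /= ?ss // => /eqP.
exists (map f I); split; rewrite ?size_map //.
- rewrite /respects sorted_map; apply: sub_in_sorted adjI; last exact: kI.
  have /(sortedP x0) sP : sorted e (x0 :: s) by [].
  move=> x y xk yk /orP [] /eqP xy /=; apply/orP; right.
    by rewrite xy; apply: sP; rewrite /= ss ltnS -xy.
  by rewrite e_sym xy; apply: sP; rewrite /= ss ltnS -xy.
- by rewrite -fwfI; apply: (run_fwf_map f_inj k (c := [::])).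
- by rewrite -fifoI; apply: (run_fifo_map f_inj k (c := [::])).
Qed.

(** The difference is never negative, and a constant sequence attains [0]: at most its first request
    faults. *)
Lemma rel_Min_fwf_fifo n : rel_Min R e (fwf_step k) (fifo_step k) n = 0%E.
Proof.
apply/eqP; rewrite eq_le; apply/andP; split; last first.
  apply: le_ereal_inf_tmp => _ [I _ <-].
  by rewrite lee_fin subr_ge0 ler_nat faults_fifo_le_fwf.
apply: ereal_inf_lbound; have [[|x0 s] [//= _ _ _]] := e_path.
have sub : {subset nseq n.-1 x0 <= [:: x0]} by move=> x; rewrite mem_nseq inE => /andP [].
exists (nseq n x0).
  split; last exact: size_nseq.
  by rewrite /respects; case: n {sub} => //= n; elim: n => //= n ->; rewrite eqxx.
congr _%:E; apply/eqP; rewrite subr_eq0 eqr_nat; apply/eqP.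
case: n sub => // n sub; rewrite /faults !run_cons fwf_add // fifo_add //=.
by rewrite (run_runs_to (fwf_runs_hits k sub)) (run_runs_to (fifo_runs_hits k sub)).
Qed.

Lemma MinG_fwf_fifo : MinG R e (fwf_step k) (fifo_step k) = 0%E.
Proof.
rewrite /MinG (_ : (fun n => _) = cst 0%E); last first.
  by apply/funext => n; rewrite rel_Min_fwf_fifo mul0e.
by have [-> _] := cvg_limn_einf_sup (cvg_cst (0%E : \bar R)).
Qed.

(** For the fault numbers [F] of FWF and [G] of FIFO, [F <= k * G + k] gives
    [F - G <= (1 - 1 / k) * F + 1], where [F <= n]. *)
Lemma MaxG_fwf_fifo_le : (MaxG R e (fwf_step k) (fifo_step k) <= (1 - k%:R^-1)%:E)%E.
Proof.
apply: limn_esup_le => n n0.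
have k0 : 0 < k%:R :> R by rewrite ltr0n.
have nR0 : 0 < n%:R :> R by rewrite ltr0n.
apply: (@le_trans _ _ (((1 - k%:R^-1) * n%:R + 1)%:E * (n%:R^-1)%:E)%E); last first.
  by rewrite -EFinM lee_fin mulrDl mul1r mulfK ?gt_eqF.
apply: lee_wpmul2r; first by rewrite lee_fin invr_ge0 ltW.
apply: ge_ereal_sup => _ [I [_ sI] <-]; rewrite lee_fin.
have h1 : (faults (fwf_step k) I)%:R <= n%:R :> R by rewrite ler_nat -sI run_le_size.
have h2 : (faults (fwf_step k) I)%:R <= k%:R * (faults (fifo_step k) I)%:R + k%:R :> R.
  by rewrite -natrM -natrD ler_nat faults_fwf_le_fifo.
set F := (faults (fwf_step k) I)%:R in h1 h2 *; set G := (faults (fifo_step k) I)%:R in h2 *.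
have h3 : F * k%:R^-1 <= G + 1 by rewrite ler_pdivrMr // mulrDl mul1r [G * _]mulrC.
have h4 : 0 <= 1 - k%:R^-1 :> R by rewrite subr_ge0 invf_le1 // ler1n.
have := ler_wpM2l h4 h1; rewrite mulrBl mul1r [_^-1 * _]mulrC; lra.
Qed.

Lemma MaxG_fwf_fifo_ge :
  ((1 - k.+1%:R / (period k)%:R)%:E <= MaxG R e (fwf_step k) (fifo_step k))%E.
Proof.
have [m hm] := bad_requests.
have p0 : (0 < period k)%N by rewrite muln_gt0 double_gt0 k_gt0 uphalf_gt0 k_gt0.
have pR0 : 0 < (period k)%:R :> R by rewrite ltr0n.
apply: limn_esup_ge => eps N eps0.
(* [t >= N] makes the sequence long enough; [t >= m / eps] keeps the loss from the prefix below
   [eps]. *)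
pose t := (N + (Num.trunc (m%:R / eps)).+1)%N.
have [I [rI sI fwfI fifoI]] := hm t.
have tm : m%:R / eps <= t%:R.
  by rewrite (le_trans (ltW (truncnS_gt _))) // ler_nat leq_addl.
have t0 : (0 < t)%N by rewrite /t addnS.
exists (m + t * period k)%N; first by rewrite /t; nia.
apply: (@le_trans _ _
  (((t * period k)%:R - (t * k.+1)%:R : R)%:E * ((m + t * period k)%:R^-1)%:E)%E); last first.
  apply: lee_wpmul2r; first by rewrite lee_fin invr_ge0.
  apply: ereal_sup_ubound; exists I; first by split.
  by rewrite fwfI fifoI !natrD; congr _%:E; ring.
rewrite -EFinM lee_fin ler_pdivlMr ?ltr0n; last by nia.
rewrite natrD (natrM _ t (period k)) (natrM _ t k.+1).
set p := (period k)%:R in pR0 *; set T := t%:R in tm *.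
have T0 : 0 <= T by rewrite ler0n.
have m0 : 0 <= m%:R :> R by rewrite ler0n.
have c0 : 0 <= k.+1%:R / p by rewrite divr_ge0 // ltW.
have p1 : 1 <= p by rewrite ler1n.
have cE : k.+1%:R = k.+1%:R / p * p by rewrite divfK ?gt_eqF.
rewrite [in X in _ <= _ - X]cE; set c := k.+1%:R / p in c0 *.
have mT : m%:R <= T * eps by rewrite -ler_pdivrMr.
have : T * eps <= T * p * eps by rewrite ler_wpM2r ?(ltW eps0) // ler_peMr.
have : 0 <= c * m%:R by rewrite mulr_ge0.
have : 0 <= eps * m%:R by rewrite mulr_ge0 // ltW.
lra.
Qed.

End Intervals.

Theorem theorem3 (R : realType) (V : eqType) (e : rel V) (k : nat) :
  symmetric e -> irreflexive e -> (1 <= k)%N -> has_path e k.+1 ->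
  (odd k ->
     (MinG R e (fwf_step k) (fifo_step k) = 0%:E /\
      MaxG R e (fwf_step k) (fifo_step k) = (1 - k%:R^-1)%:E)) /\
  (~~ odd k ->
     ([set x : R | 0 <= x <= (k%:R ^+ 2 - k%:R - 1) / k%:R ^+ 2]
        `<=` [set x | in_rel_interval e (fwf_step k) (fifo_step k) x]) /\
     ([set x | in_rel_interval e (fwf_step k) (fifo_step k) x]
        `<=` [set x : R | 0 <= x <= (k%:R - 1) / k%:R])).
Proof.
move=> e_sym _ k_gt0 e_path.
have kR0 : k%:R != 0 :> R by rewrite pnatr_eq0 -lt0n.
have MaxG_le := @MaxG_fwf_fifo_le R V e k k_gt0.
have MaxG_ge := @MaxG_fwf_fifo_ge R V e k e_sym k_gt0 e_path.
have Min0 := @MinG_fwf_fifo R V e k k_gt0 e_path.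
split=> k_parity; first split=> //.
  apply/eqP; rewrite eq_le MaxG_le; apply: le_trans MaxG_ge; rewrite lee_fin.
  (* For odd [k] the fraction [(k + 1) / period k] is thus [1 / k], matching the upper bound. *)
  have -> : (period k = k * k.+1)%N.
    by have := odd_double_half k; rewrite /period uphalf_half k_parity -muln2; nia.
  by rewrite natrM invfM mulrCA divff ?mulr1.
split=> x /=; rewrite /in_rel_interval Min0; last first.
  move=> /andP [x0 xM]; rewrite !lee_fin in x0 *; rewrite x0 /= mulrBl divff // mul1r.
  by rewrite -lee_fin (le_trans xM).
move=> /andP [x0 xle]; rewrite lee_fin x0 /=; apply: le_trans MaxG_ge; rewrite lee_fin.
(* For even [k] the lower bound is thus [1 - (k + 1) / k ^ 2]. *)
have -> : (period k = k ^ 2)%N.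
  have := odd_double_half k; rewrite /period uphalf_half (negbTE k_parity).
  by rewrite -!muln2 !add0n => {2 3}<-; nia.
apply: le_trans xle _; rewrite natrX -natr1 le_eqVlt; apply/orP; left; apply/eqP.
by field.
Qed.
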